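(* Let $p$ and $q$ be primes and let $(P,\alpha)$ be a maximal $(p,q)$-pair of rank $2$. Assume that $p=3$. Then $P$ is isomorphic to one of the following: (1) an elementary abelian group of order $9$; (2) an extraspecial group of order $27$ and exponent $3$; (3) the group SmallGroup(81,10).
   Context: For a finite group $G$, $\mathrm{d}(G)$ denotes the minimum number of generators of $G$ and $\Phi(G)$ its Frattini subgroup. A power automorphism of a finite group is an automorphism sending every subgroup to itself. Let $p,q$ be primes. A maximal $(p,q)$-pair of rank $d$ is a pair $(P,\alpha)$ where $P$ is a finite $p$-group, $\alpha\in\mathrm{Aut}(P)$ has prime order $q$ dividing $p-1$, and: (a) the minimal number of generators of every subgroup of $P$ is at most $\mathrm{d}(P)=d$; (b) the image of $\alpha$ in $\mathrm{Aut}(P/\Phi(P))$ is a non-trivial power automorphism; (c) if $H$ is a proper subgroup of $P$ with $\mathrm{d}(H)=\mathrm{d}(P)$, then either $\alpha(H)\neq H$ or the image of $\alpha$ in $\mathrm{Aut}(H/\Phi(H))$ is not a non-trivial power automorphism. SmallGroup$(n,k)$ denotes the $k$-th group of order $n$ in the SmallGroups library of the computer algebra system GAP. *)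

(* Defs.v *)
From mathcomp Require Import all_boot all_fingroup all_solvable.

Set Implicit Arguments.
Unset Strict Implicit.
Unset Printing Implicit Defensive.

Local Open Scope group_scope.

Definition power_automorphism (gT : finGroupType) (G : {group gT})
    (b : {perm gT}) : Prop :=
  b \in Aut G /\ forall K : {group gT}, K \subset G -> b @: K = K.

(* [b] is the image in Aut (H / 'Phi(H)) of the automorphism of H given by the
   restriction of [a].  When a @: H = H this determines [b]: see
   [exists_unique_frattini_quotient_aut]. *)
Definition frattini_quotient_aut (gT : finGroupType) (H : {group gT})
    (a : {perm gT}) (b : {perm coset_of 'Phi(H)}) : Prop :=
  b \in Aut (H / 'Phi(H)) /\
  {in H, forall x, b (coset 'Phi(H) x) = coset 'Phi(H) (a x)}.

Lemma exists_unique_frattini_quotient_aut (gT : finGroupType)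
    (P H : {group gT}) (a : {perm gT}) :
  a \in Aut P -> H \subset P -> a @: H = H ->
  exists! b : {perm coset_of 'Phi(H)}, frattini_quotient_aut a b.
Proof.
move=> Aa sHP aH.
have Nagr: a \in 'N(H | 'P).
  apply/astabsP=> x /=; rewrite /aperm -{1}aH.
  by rewrite mem_imset //; apply: perm_inj.
have Ar: restr_perm H a \in Aut H.
  rewrite inE restr_perm_on; apply/morphicP=> x y Hx Hy.
  rewrite !restr_permE ?groupM //.
  by apply: (morphicP (Aut_morphic Aa)); apply: (subsetP sHP).
pose f := [morphism of autm Ar].
have nPhi: 'Phi(H) <| H by apply: Phi_normal.
have sPhiH: 'Phi(H) \subset H by apply: Phi_sub.
have fPhi: f @* 'Phi(H) = 'Phi(H).
  by have /charP[_ -> //] := Phi_char H; rewrite ?injm_autm ?im_autm.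
have fH : f @* H = H by apply: im_autm.
have: exists q : {morphism (H / 'Phi(H)) >-> coset_of (f @* 'Phi(H))},
    [/\ {in H, forall x, q (coset 'Phi(H) x) = coset (f @* 'Phi(H)) (f x)},
        'injm q & q @* (H / 'Phi(H)) = H / (f @* 'Phi(H))].
  exists [morphism of quotm f nPhi]; split.
  - exact: quotmE.
  - by apply: injm_quotm; apply: injm_autm.
  - by rewrite morphim_quotm fH.
rewrite fPhi => -[q [qE injq imq]].
exists (aut injq imq); split=> [|b [Ab bE]].
  split=> [|x Hx]; first exact: Aut_aut.
  by rewrite autE ?mem_quotient // qE // -[f x]/(restr_perm H a x) restr_permE.
apply: (eq_Aut (Aut_aut injq imq) Ab) => _ /morphimP[x _ Hx ->].
rewrite [RHS]bE // autE ?mem_quotient // qE //.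
by rewrite -[f x]/(restr_perm H a x) restr_permE.
Qed.

Definition nontrivial_power_on_frattini_quotient (gT : finGroupType)
    (H : {group gT}) (a : {perm gT}) : Prop :=
  exists b : {perm coset_of 'Phi(H)},
    [/\ frattini_quotient_aut a b,
        power_automorphism (H / 'Phi(H))%G b
      & b != 1].

(* [P] is a subgroup of an ambient finite group type, and [a \in Aut P] is
   represented by a permutation of that type fixing all points outside [P].
   ['m(H)] is the minimal number of generators of [H]. *)
Record maximal_pair (p q d : nat) (gT : finGroupType) (P : {group gT})
    (a : {perm gT}) : Prop := MaximalPair {
  maximal_pair_prime_p : prime p;
  maximal_pair_prime_q : prime q;
  maximal_pair_dvd : q %| p - 1;
  maximal_pair_pgroup : p.-group P;
  maximal_pair_Aut : a \in Aut P;
  maximal_pair_order : #[a] = q;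
  maximal_pair_rank : 'm(P) = d;
  maximal_pair_subgroups :
    forall H : {group gT}, H \subset P -> 'm(H) <= d;
  maximal_pair_power : nontrivial_power_on_frattini_quotient P a;
  maximal_pair_maximal :
    forall H : {group gT}, H \proper P -> 'm(H) = 'm(P) ->
      a @: H <> H \/ ~ nontrivial_power_on_frattini_quotient H a
}.

(* The power-commutator presentation of SmallGroup(81,10): f4 is central,
   [~ f2, f1] = f3, [~ f3, f1] = f4 and [~ f3, f2] = 1.  It is consistent, so
   the group has order 81; it is the group of maximal class of order 81 that
   has exactly 8 elements of order 3. *)
Definition is_SmallGroup_81_10 (gT : finGroupType) (G : {group gT}) : Prop :=
  G \isog Grp (f1 : f2 : f3 : f4 :
    f1 ^+ 3 = f4, f2 ^+ 3 = f4 ^+ 2, f3 ^+ 3 = 1, f4 ^+ 3 = 1,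
    [~ f2, f1] = f3, [~ f3, f1] = f4, [~ f3, f2] = 1,
    [~ f4, f1] = 1, [~ f4, f2] = 1, [~ f4, f3] = 1).

(* Main.v *)
Require Import Defs.
From mathcomp Require Import all_boot all_fingroup all_solvable.

(** Here [q = 2] and the automorphism [a] inverts [P / 'Phi(P)].  Every element
    [(a g)^-1 * g] is inverted by [a], so [P] is generated by two inverted
    elements [x] and [y].  Maximality says that two inverted elements generate
    [P] or a cyclic group; hence all inverted elements outside ['Phi(P)] have
    cubes generating one and the same central cyclic group [Z], which contains
    every inverted element of ['Phi(P)].  Since [a] acts trivially on
    ['Phi(P)] modulo [Z], ['Phi(P)] is central in [P] modulo [Z].  This gives a
    formula for the cube of [y * x ^+ (l + l)], a conjugate of the inverted
    element [x ^+ l * y * x ^+ l].  This cube generates [Z] for every [l], so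
    [Z] has order 1 or 3; the first case gives the groups of order 9 and 27, and
    in the second one the same constraint determines the relations of a group
    of order 81. *)

Set Implicit Arguments.
Unset Strict Implicit.
Unset Printing Implicit Defensive.

Local Open Scope group_scope.

(** * The cube of a product when [[~ d, g]] and [[~ d, h]] are central, [d] being [[~ g, h]] *)

Section CubeFormula.

Variables (gT : finGroupType) (g h d t u : gT).
Hypotheses (dE : [~ g, h] = d) (tE : [~ d, g] = t) (uE : [~ d, h] = u).
Hypotheses (ctg : commute t g) (cth : commute t h).
Hypotheses (cug : commute u g) (cuh : commute u h).
Hypotheses (cg3h : commute (g ^+ 3) h).

Let commute_d (z : gT) : commute z g -> commute z h -> commute z d.
Proof.
move=> zg zh; rewrite -dE.
by do !apply: commuteM => //; apply: commuteV.
Qed.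

(** Conjugation by [g ^+ 3] fixes [d], but it also multiplies [d] by [t ^+ 3]. *)
Lemma commg_right_cube : t ^+ 3 = 1.
Proof.
have ctd : commute t d by apply: commute_d.
have cg3d : commute (g ^+ 3) d.
  by apply: commute_d => //; apply/commute_sym/commuteX.
have dg : d ^ g = d * t by rewrite conjg_mulR tE.
have tg : t ^ g = t by apply/conjg_fixP/commgP.
have dtg : (d * t) ^ g = d * t * t by rewrite conjMg dg tg.
have: d ^ (g ^+ 3) = d by apply/conjg_fixP/commgP/commute_sym.
rewrite !expgS expg0 !mulg1 !conjgM dg dtg (conjMg (d * t)) dtg tg.
by move=> e; apply/(mulgI d); rewrite [RHS]mulg1 -[RHS]e !mulgA.
Qed.

(** Expanding the trivial commutator [[~ g ^+ 3, h]] gives [d ^+ 3 * t ^+ 3]. *)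
Lemma commg_cube : d ^+ 3 = 1.
Proof.
have ctd : commute t d by apply: commute_d.
have dg : d ^ g = d * t by rewrite conjg_mulR tE.
have tg : t ^ g = t by apply/conjg_fixP/commgP.
have: [~ g ^+ 3, h] = 1 by apply/eqP/commgP.
rewrite !expgS expg0 !mulg1 !commMgJ dE conjgM !dg conjMg dg tg.
move=> e; rewrite -[RHS]e.
have -> : d * t * t * (d * t * d) = d * d * d * (t ^+ 3).
  rewrite !expgS expg0 !mulg1 !mulgA.
  by do ![rewrite -[_ * t * d]mulgA ctd mulgA].
by rewrite commg_right_cube mulg1 mulgA.
Qed.

(** Collecting the factors [h], then [g], to the left leaves the tail [d ^+ 3 * t ^+ 5 * u]. The
    cubes of [d] and [t] vanish, and [t ^+ 5 = t^-1]. *)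
Lemma expg3_mulg_commg : (h * g) ^+ 3 = h ^+ 3 * g ^+ 3 * (t^-1 * u).
Proof.
have ctd : commute t d by apply: commute_d.
have cud : commute u d by apply: commute_d.
have gh : g * h = h * g * d by rewrite -dE commgC.
have dg : d * g = g * d * t by rewrite -tE commgC.
have dh : d * h = h * d * u by rewrite -uE commgC.
have -> : t^-1 = t * t.
  apply/(mulgI t); rewrite mulgV -commg_right_cube.
  by rewrite !expgS expg0 mulg1.
rewrite !expgS !expg0 !mulg1 !mulgA.
have gg z : z * g * h = z * h * g * d by rewrite -mulgA gh !mulgA.
have dd z : z * d * g = z * g * d * t by rewrite -mulgA dg !mulgA.
have dd' z : z * d * h = z * h * d * u by rewrite -mulgA dh !mulgA.
have tg z : z * t * g = z * g * t by rewrite -mulgA ctg mulgA.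
have td z : z * t * d = z * d * t by rewrite -mulgA ctd mulgA.
have ug z : z * u * g = z * g * u by rewrite -mulgA cug mulgA.
have ud z : z * u * d = z * d * u by rewrite -mulgA cud mulgA.
have ut z : z * u * t = z * t * u.
  rewrite -mulgA (_ : u * t = t * u) ?mulgA //; rewrite -tE.
  by do !apply: commuteM => //; apply: commuteV => //; apply: cud.
rewrite !gg !dd' !gg.
do ![rewrite dd | rewrite tg | rewrite td
    | rewrite ug | rewrite ud | rewrite ut].
have t3z z : z * t * t * t = z.
  by rewrite -[RHS]mulg1 -commg_right_cube !expgS expg0 mulg1 !mulgA.
have d3z z : z * d * d * d = z.
  by rewrite -[RHS]mulg1 -commg_cube !expgS expg0 mulg1 !mulgA.
by rewrite d3z t3z.
Qed.

End CubeFormula.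

(** * Recognition of SmallGroup(81,10) from its relations and its order *)

Lemma card_cycle_joing_le3 (gT : finGroupType) (H : {group gT}) (g : gT) :
  g \in 'N(H) -> g ^+ 3 \in H -> #|<[g]> <*> H| <= 3 * #|H|.
Proof.
move=> nHg g3H; have sgN : <[g]> \subset 'N(H) by rewrite cycle_subG.
have nsH : H <| <[g]> <*> H by rewrite normalYr.
rewrite -(Lagrange (normal_sub nsH)) mulnC leq_mul2r.
rewrite -card_quotient ?normal_norm //.
rewrite quotientYidr // quotient_cycle // -orderE dvdn_leq ?orbT //.
by rewrite order_dvdn -morphX //= coset_id.
Qed.

(** In the chain [H4], [H3], [H2] each subgroup is normalized by the next generator and contains its
    cube, so each of the four steps contributes a factor of at most 3. *)
Lemma card_SmallGroup_81_10_relations (gT : finGroupType) (f1 f2 f3 f4 : gT) :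
    f1 ^+ 3 = f4 -> f2 ^+ 3 = f4 ^+ 2 -> f3 ^+ 3 = 1 -> f4 ^+ 3 = 1 ->
    [~ f2, f1] = f3 -> [~ f3, f1] = f4 -> [~ f3, f2] = 1 ->
    [~ f4, f1] = 1 -> [~ f4, f2] = 1 -> [~ f4, f3] = 1 ->
  #|<[f1]> <*> (<[f2]> <*> (<[f3]> <*> <[f4]>))| <= 81.
Proof.
move=> r1 r2 r3 r4 c21 c31 c32 c41 c42 c43.
set H4 := <[f4]>; set H3 := _ <*> H4; set H2 := _ <*> H3.
have nconj (x y z : gT) (K : {group gT}) :
  [~ x, y] = z -> x \in K -> z \in K -> x ^ y \in K.
  by move=> <- Kx Kz; rewrite conjg_mulR groupM.
have f44 : f4 \in H4 by apply: cycle_id.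
have f43 : f4 \in H3 by rewrite mem_gen // inE f44 orbT.
have f33 : f3 \in H3 by rewrite mem_gen // inE cycle_id.
have f42 : f4 \in H2 by rewrite mem_gen // inE f43 orbT.
have f32 : f3 \in H2 by rewrite mem_gen // inE f33 orbT.
have f22 : f2 \in H2 by rewrite mem_gen // inE cycle_id.
have n4 : f3 \in 'N(H4).
  by rewrite inE -cycleJ cycle_subG (nconj _ _ _ _ c43) ?group1.
have n3 : f2 \in 'N(H3).
  rewrite inE conjYg -!cycleJ join_subG !cycle_subG.
  by rewrite (nconj _ _ _ _ c42) ?(nconj _ _ _ _ c32) ?group1.
have n2 : f1 \in 'N(H2).
  rewrite inE !conjYg -!cycleJ !join_subG !cycle_subG.
  rewrite (nconj _ _ _ _ c21) ?(nconj _ _ _ _ c31) ?(nconj _ _ _ _ c41) //;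
    by rewrite ?group1.
have l1 := card_cycle_joing_le3 n2; have l2 := card_cycle_joing_le3 n3.
have l3 := card_cycle_joing_le3 n4.
have l4 : #|H4| <= 3 by rewrite dvdn_leq // -orderE order_dvdn r4.
apply: leq_trans (l1 _) _; first by rewrite r1.
rewrite (@leq_pmul2l 3 _ 27) //.
apply: leq_trans (l2 _) _; first by rewrite r2 groupX.
rewrite (@leq_pmul2l 3 _ 9) //.
apply: leq_trans (l3 _) _; first by rewrite r3 group1.
by rewrite (@leq_pmul2l 3 _ 3).
Qed.

(** The relations allow at most 81 elements, so a group of order at least 81 satisfying them maps
    onto every other one. Generation by [f1] and [f2] suffices because [f3] and [f4] are
    commutators. *)
Lemma isoGrp_SmallGroup_81_10 (gT : finGroupType) (P : {group gT})
    (f1 f2 f3 f4 : gT) :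
    f1 ^+ 3 = f4 -> f2 ^+ 3 = f4 ^+ 2 -> f3 ^+ 3 = 1 -> f4 ^+ 3 = 1 ->
    [~ f2, f1] = f3 -> [~ f3, f1] = f4 -> [~ f3, f2] = 1 ->
    [~ f4, f1] = 1 -> [~ f4, f2] = 1 -> [~ f4, f3] = 1 ->
    <[f1]> <*> <[f2]> = P -> 81 <= #|P| ->
  is_SmallGroup_81_10 P.
Proof.
move=> r1 r2 r3 r4 c21 c31 c32 c41 c42 c43 defP leP.
have [Pf1 Pf2]: f1 \in P /\ f2 \in P.
  by rewrite -defP; split; rewrite mem_gen // inE cycle_id ?orbT.
have Pf3 : f3 \in P by rewrite -c21 groupR.
have Pf4 : f4 \in P by rewrite -c31 groupR.
have def4 : <[f1]> <*> <[f2]> <*> <[f3]> <*> <[f4]> = P.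
  by rewrite defP !(joing_idPl _) ?cycle_subG // !(joing_idPl _) ?cycle_subG.
apply: intro_isoGrp => [|rT H].
  apply/existsP; exists (f1, f2, f3, f4).
  by rewrite /= !xpair_eqE /= def4 r1 r2 r3 r4 c21 c31 c32 c41 c42 c43 !eqxx.
case/existsP=> -[[[h1 h2] h3] h4] /= /eqP[defH].
move=> s1 s2 s3 s4 d21 d31 d32 d41 d42 d43.
(* [K] is a subdirect product of [P] and [H] satisfying the relations, so its
   order forces the projection to [P] to be an isomorphism. *)
pose k1 := (f1, h1); pose k2 := (f2, h2).
pose k3 := (f3, h3); pose k4 := (f4, h4).
pose K := (<[k1]> <*> (<[k2]> <*> (<[k3]> <*> <[k4]>)))%G.
have leK : #|K| <= 81.
  by apply: card_SmallGroup_81_10_relations; rewrite /commg /conjg; congr pair.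
have imfst : fst @* K = P.
  rewrite !morphimY ?subsetT // !morphim_cycle ?inE //=.
  by rewrite -def4 -!joingA.
have imsnd : snd @* K = H.
  rewrite !morphimY ?subsetT // !morphim_cycle ?inE //=.
  by rewrite -defH -!joingA.
have homPK : P \homg K by rewrite -imfst morphim_homg ?subsetT.
have homHK : H \homg K by rewrite -imsnd morphim_homg ?subsetT.
apply: homg_trans homHK _; apply: isog_hom; rewrite isog_sym.
by rewrite isogEcard homPK (leq_trans leK).
Qed.

(** * Elements inverted by an involutive automorphism of a 3-group *)

Section InvertedGenerators.

Variables (gT : finGroupType) (P : {group gT}) (a : {perm gT}).
Hypotheses (pP : 3.-group P) (Aa : a \in Aut P) (aK : involutive a).
Hypothesis ncP : ~~ cyclic P.

Local Notation F := 'Phi(P).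
Let I := [set g in P | a g == g^-1].

Hypothesis cardP : #|P| = (9 * #|F|)%N.
Hypothesis cyclic_inverted : forall u v, u \in I -> v \in I ->
  <[u]> <*> <[v]> \proper P -> cyclic (<[u]> <*> <[v]>).

Let aM : {in P &, {morph a : x y / x * y}}.
Proof. exact: (morphicP (Aut_morphic Aa)). Qed.

Let aV : {in P, {morph a : x / x^-1}}.
Proof. by move=> x Px; rewrite -!(autmE Aa) morphV. Qed.

Let aX n : {in P, {morph a : x / x ^+ n}}.
Proof. by move=> x Px; rewrite -!(autmE Aa) morphX. Qed.

Let aP x : x \in P -> a x \in P.
Proof. exact: Aut_closed. Qed.

Let aF x : x \in F -> a x \in F.
Proof.
move=> Fx; have /charP[_ /(_ _ (injm_autm Aa) (im_autm Aa)) <-] := Phi_char P.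
by rewrite -(autmE Aa) mem_morphim // (subsetP (Phi_sub P)).
Qed.

Let IP x : x \in I -> x \in P. Proof. by case/setIdP. Qed.

Let aI x : x \in I -> a x = x^-1. Proof. by case/setIdP=> _ /eqP. Qed.

Let memI x : x \in P -> a x = x^-1 -> x \in I.
Proof. by move=> Px ax; rewrite inE Px ax eqxx. Qed.

Let IX n x : x \in I -> x ^+ n \in I.
Proof.
by move=> Ix; apply: memI; rewrite ?groupX ?IP // aX ?IP // aI // expgVn.
Qed.

Let IJ x y : x \in I -> y \in I -> x * y * x \in I.
Proof.
move=> Ix Iy; have Px := IP Ix; have Py := IP Iy.
by apply: memI; rewrite ?groupM // !aM ?groupM // !aI // !invMg !mulgA.
Qed.

Lemma inverted_divg x : x \in P -> (a x)^-1 * x \in I.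
Proof.
move=> Px; have Pax := aP Px.
by apply: memI; rewrite ?groupM ?groupV // aM ?groupV // aV // aK invMg invgK.
Qed.

Let cubeF x : x \in P -> x ^+ 3 \in F.
Proof.
move=> Px; rewrite (Phi_joing pP) mem_gen // inE; apply/orP; right.
by rewrite (Mho_p_elt 1) // (mem_p_elt pP).
Qed.

Let commF g h : g \in P -> h \in P -> [~ g, h] \in F.
Proof. by move=> Pg Ph; rewrite (Phi_joing pP) mem_gen // inE mem_commg. Qed.

Let root3 k x : x \in P -> ~~ (3 %| k) -> x \in <[x ^+ k]>.
Proof.
move=> Px n3k; suff /eqP <- : generator <[x]> (x ^+ k) by apply: cycle_id.
rewrite generator_coprime; apply: (@pnat_coprime 3).
  exact: mem_p_elt pP Px.
by rewrite p'natE.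
Qed.

(** Since [f] is a non-generator and [P] is not cyclic, [w] and [f] generate a proper subgroup,
    which is therefore cyclic. As [w] is outside [F], it generates this subgroup, so [f] is a power
    of [w]; an exponent prime to 3 would put [w] in [F]. *)
Lemma inverted_Phi w f :
  w \in I -> w \notin F -> f \in I -> f \in F -> f \in <[w ^+ 3]>.
Proof.
move=> Iw nFw If Ff; have Pw := IP Iw; have Pf := IP If.
have prC : <[w]> <*> <[f]> \proper P.
  rewrite properE join_subG !cycle_subG Pw Pf /=; apply: contra ncP => sPC.
  apply/cyclicP; exists w; rewrite -[RHS]genGid; apply/esym/Phi_nongen.
  apply/eqP; rewrite eqEsubset join_subG Phi_sub cycle_subG Pw /=.
  by rewrite (subset_trans sPC) // joingC genS // setSU // cycle_subG.
have /cyclicP[g defC] := cyclic_inverted Iw If prC.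
have wg : w \in <[g]> by rewrite -defC mem_gen // inE cycle_id.
have fg : f \in <[g]> by rewrite -defC mem_gen // inE cycle_id orbT.
have Pg : g \in P by rewrite -cycle_subG -defC proper_sub.
have{wg} gw : g \in <[w]>.
  have /cycleP[k wE] := wg; rewrite wE root3 //.
  apply: contra nFw => /dvdnP[m kE].
  by rewrite wE kE mulnC expgM groupX ?cubeF.
have /cycleP[k fE] : f \in <[w]> by move: fg; apply/subsetP; rewrite cycle_subG.
have [/dvdnP[m kE]|n3k] := boolP (3 %| k).
  by rewrite fE kE mulnC expgM mem_cycle.
case/negP: nFw; have := root3 Pw n3k; rewrite -fE; apply/subsetP.
by rewrite cycle_subG.
Qed.

Definition inverted_gens x y := [/\ x \in I, y \in I & <[x]> <*> <[y]> = P].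

Lemma inverted_gensC x y : inverted_gens x y -> inverted_gens y x.
Proof. by case=> Ix Iy defP; split; rewrite // joingC. Qed.

Lemma inverted_gens_notin_Phi x y : inverted_gens x y -> x \notin F.
Proof.
case=> Ix Iy defP; apply: contra ncP => Fx; apply/cyclicP; exists y.
rewrite -[RHS]genGid; apply/esym/Phi_nongen; apply/eqP.
rewrite eqEsubset join_subG Phi_sub cycle_subG (IP Iy) /= -{1}defP genS //.
by rewrite setSU // cycle_subG.
Qed.

(** * The central subgroup generated by cubes, for a fixed pair of inverted generators *)

Section Pair.

Variables x y : gT.
Hypothesis gen_xy : inverted_gens x y.

Let Ix : x \in I. Proof. by case: gen_xy. Qed.
Let Iy : y \in I. Proof. by case: gen_xy. Qed.
Let defP : <[x]> <*> <[y]> = P. Proof. by case: gen_xy. Qed.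
Let nFx : x \notin F. Proof. exact: inverted_gens_notin_Phi gen_xy. Qed.
Let nFy : y \notin F.
Proof. exact: inverted_gens_notin_Phi (inverted_gensC gen_xy). Qed.

Local Notation Z := <[x ^+ 3]>.

(** [inverted_Phi] gives both inclusions, since [w ^+ 3] and [x ^+ 3] are inverted elements of
    [F]. *)
Lemma cycle_cube_inverted w : w \in I -> w \notin F -> <[w ^+ 3]> = Z.
Proof.
move=> Iw nFw; apply/eqP; rewrite eqEsubset !cycle_subG.
by rewrite !inverted_Phi ?IX ?cubeF ?IP.
Qed.

Lemma commute_gens z :
  commute z x -> commute z y -> forall g, g \in P -> commute z g.
Proof.
move=> zx zy g Pg; apply/commute_sym/cent1P.
suff /subsetP-> : P \subset 'C[z] by [].
by rewrite -defP join_subG !cycle_subG; apply/andP; split;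
  apply/cent1P/commute_sym.
Qed.

(** [Z] is generated by [x ^+ 3] and also by [y ^+ 3], so it centralizes both generators. *)
Lemma central_cube z : z \in Z -> forall g, g \in P -> commute z g.
Proof.
move=> Zz; apply: commute_gens.
  by have /cycleP[k ->] := Zz; rewrite -expgM; apply/commute_sym/commuteX.
move: Zz; rewrite -(cycle_cube_inverted Iy nFy) => /cycleP[k ->].
by rewrite -expgM; apply/commute_sym/commuteX.
Qed.

(* [a] fixes [f] modulo [Z], so applying it to [f ^ g] gives
   [f ^ g^-1 = f ^ g] modulo [Z]; so [f] commutes with [g ^+ 2] modulo [Z]. *)
Lemma commg_Phi f g : f \in F -> g \in I -> [~ f, g] \in Z.
Proof.
have aFZ h : h \in F -> exists2 z, z \in Z & a h = h * z.
  move=> Fh; have Ph := subsetP (Phi_sub P) h Fh.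
  exists ((a h)^-1 * h)^-1; last by rewrite invMg invgK mulKVg.
  by rewrite groupV inverted_Phi ?inverted_divg ?groupM ?groupV ?aF.
move=> Ff Ig; have Pg := IP Ig; have Pf := subsetP (Phi_sub P) f Ff.
have [z Zz afE] := aFZ f Ff.
have Ffg : f ^ g \in F.
  by rewrite memJ_norm // (subsetP (normal_norm (Phi_normal P))).
have [z' Zz' afgE] := aFZ _ Ffg.
have fixZ s h : s \in Z -> h \in P -> s ^ h = s.
  by move=> Zs Ph; apply/conjg_fixP/commgP/central_cube.
have fgg : f ^ (g ^+ 2) = f * (z * z'^-1).
  move: afgE; rewrite !aM ?groupM ?groupV // aV // (aI Ig) afE invgK => e.
  apply: (mulIg z'); rewrite [f * _]mulgA mulgKV !expgS expg0 mulg1 conjgM.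
  by rewrite -{1}(fixZ z' g) // -conjMg -e /conjg !mulgA mulVg mul1g mulgKV.
set s := z * z'^-1 in fgg; have Zs : s \in Z by rewrite groupM ?groupV.
(* To pass from [g ^+ 2] to [g]: [g ^+ 3] lies in [Z] and is central, while conjugating twice by
   [g ^+ 2] multiplies [f] by [s ^+ 2]. Hence [[~ f, g] = s ^+ 2]. *)
have: f ^ (g ^+ 4) = f ^ g.
  rewrite (expgD g 3 1) conjgM; congr (_ ^ _); apply/conjg_fixP/commgP.
  by apply/commute_sym/central_cube => //; rewrite inverted_Phi ?IX ?cubeF.
rewrite (expgD g 2 2) conjgM fgg conjMg fgg (fixZ s) ?groupX // => e.
by rewrite commgEl -e -(mulgA f) mulKg groupM.
Qed.

Lemma mem_inverted_cube g : g \in I -> g ^+ 3 \in Z.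
Proof. by move=> Ig; rewrite inverted_Phi ?IX ?cubeF ?IP. Qed.

(** The cube formula applies with [h := y]: [d] lies in [F], so its commutators with [g] and [y] lie
    in the central subgroup [Z], as does [g ^+ 3]. *)
Lemma mulg_inverted_cube g (d := [~ g, y]) : g \in I ->
  [/\ d ^+ 3 = 1, [~ d, g] ^+ 3 = 1, [~ d, y] ^+ 3 = 1
    & (y * g) ^+ 3 = y ^+ 3 * g ^+ 3 * ([~ d, g]^-1 * [~ d, y])].
Proof.
move=> Ig; have Pg := IP Ig; have Py := IP Iy.
have Pd : d \in P by apply: groupR.
have Fd : d \in F by apply: commF.
have cg3y : commute (g ^+ 3) y.
  by apply: central_cube; rewrite ?mem_inverted_cube.
have Zt := commg_Phi Fd Ig; have Zu := commg_Phi Fd Iy.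
have [ctg cty] : commute [~ d, g] g /\ commute [~ d, g] y.
  by split; apply: central_cube.
have [cug cuy] : commute [~ d, y] g /\ commute [~ d, y] y.
  by split; apply: central_cube.
have cud : commute [~ d, y] d by apply: central_cube.
have d3 := commg_cube (erefl d) (erefl [~ d, g]) ctg cty cg3y.
split=> //.
- exact: commg_right_cube (erefl d) (erefl [~ d, g]) ctg cty cg3y.
- by rewrite -commXg // d3 comm1g.
exact: (expg3_mulg_commg (erefl d) (erefl [~ d, g]) (erefl [~ d, y])).
Qed.

(** The symmetric product keeps the second generator inverted, which [y * x ^+ (l + l)] need not
    be. *)
Lemma inverted_gens_sandwich l : inverted_gens x (x ^+ l * y * x ^+ l).
Proof.
split=> //; first by rewrite IJ ?IX.
have Px := IP Ix; have Py := IP Iy.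
apply/eqP; rewrite eqEsubset join_subG !cycle_subG !groupM ?groupX ?Px //=.
rewrite -defP join_subG !cycle_subG; set H := (_ <*> _)%G.
have Hx : x \in H by rewrite mem_gen // inE cycle_id.
have Hw : x ^+ l * y * x ^+ l \in H by rewrite -cycle_subG joing_subr.
have -> : y = x ^- l * (x ^+ l * y * x ^+ l) * x ^- l.
  by rewrite !mulgA mulVg mul1g mulgK.
by rewrite Hx; apply: groupM; [apply: groupM|]; rewrite // groupV groupX.
Qed.

Lemma sandwich_cube l (g := x ^+ (l + l)) (d := [~ g, y]) :
  (x ^+ l * y * x ^+ l) ^+ 3 = y ^+ 3 * g ^+ 3 * ([~ d, g]^-1 * [~ d, y]).
Proof.
have Ig : g \in I by apply: IX.
have [_ _ _ e] := mulg_inverted_cube Ig; have Fd : d \in F by rewrite commF ?IP.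
have -> : x ^+ l * y * x ^+ l = (y * g) ^ (x ^- l).
  by rewrite /conjg invgK /g expgD !mulgA mulgK.
rewrite -conjXg e; apply/conjg_fixP/commgP/central_cube.
  apply: groupM; first by apply: groupM; apply: mem_inverted_cube.
  by apply: groupM; rewrite ?groupV; apply: commg_Phi.
by rewrite groupV groupX ?IP.
Qed.

(** As 2 is prime to 3, [x ^+ 6] still generates [Z], which contains [y ^+ 3]. For this [l] only the
    commutator part of [sandwich_cube] survives. *)
Lemma exists_sandwich_cube_cancel : exists l, y ^+ 3 * (x ^+ (l + l)) ^+ 3 = 1.
Proof.
have : (y ^+ 3)^-1 \in <[(x ^+ 3) ^+ 2]>.
  have s : Z \subset <[(x ^+ 3) ^+ 2]> by rewrite cycle_subG root3 ?groupX ?IP.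
  by rewrite groupV; apply: (subsetP s); apply: mem_inverted_cube.
case/cycleP=> l yE; exists l.
by rewrite addnn -mul2n -expgM mulnC mulnA expgM (expgM x 3 2) -yE mulgV.
Qed.

Lemma cycle_cube_sandwich l : <[(x ^+ l * y * x ^+ l) ^+ 3]> = Z.
Proof.
have gens := inverted_gens_sandwich l.
apply: cycle_cube_inverted; first by case: gens.
exact: inverted_gens_notin_Phi (inverted_gensC gens).
Qed.

(** For the cancelling [l], [Z] is generated by a product of two central elements whose cubes are
    trivial. *)
Lemma order_cube_dvdn : #[x ^+ 3] %| 3.
Proof.
have [l e] := exists_sandwich_cube_cancel.
rewrite /order -(cycle_cube_sandwich l) -orderE order_dvdn.
rewrite sandwich_cube e mul1g.
have Ig := IX (l + l) Ix; have [_ t3 u3 _] := mulg_inverted_cube Ig.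
have Zt := commg_Phi (commF (IP Ig) (IP Iy)) Ig.
rewrite expgMn ?expgVn ?t3 ?u3 ?mulg1 ?invg1 //.
by apply: central_cube; rewrite ?groupV // !groupR ?IP.
Qed.

(** For the cancelling [l], the commutators whose product generates [Z] are both trivial. *)
Lemma expg3_central_commg :
  commute [~ x, y] x -> commute [~ x, y] y -> x ^+ 3 = 1.
Proof.
move=> cx cy; have [l e] := exists_sandwich_cube_cancel.
apply/eqP; rewrite -cycle_eq1 -(cycle_cube_sandwich l) cycle_eq1.
rewrite sandwich_cube e mul1g.
rewrite (commXg _ (commute_sym cx)).
set n := l + l.
have /commgP/eqP-> : commute ([~ x, y] ^+ n) (x ^+ n) by apply: commuteX2.
have /commgP/eqP-> : commute ([~ x, y] ^+ n) y.
  exact/commute_sym/commuteX/commute_sym.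
by rewrite invg1 mulg1.
Qed.

End Pair.

(** Let [c = [~ x, y]] and [t = [~ c, x]]. If [t = 1], exchanging the generators works. Otherwise
    [t] generates [Z], so [[~ c, y] = t ^+ k] for some [k], and [y] is replaced by
    [x ^+ k * y * x ^+ k]. *)
Lemma exists_commuting_inverted_gens x y : inverted_gens x y ->
  exists x' y', inverted_gens x' y' /\ commute [~ x', y'] y'.
Proof.
move=> gens; have [Ix Iy _] := gens.
have Fc : [~ x, y] \in F by rewrite commF ?IP.
have Zt := commg_Phi gens Fc Ix; have Zu := commg_Phi gens Fc Iy.
have [t1|nt1] := eqVneq [~ x, y, x] 1.
  exists y, x; split; first exact: inverted_gensC.
  by rewrite -invgR; apply/commute_sym/commuteV/commute_sym/commgP/eqP.
have oZ : #|<[x ^+ 3]>| = 3.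
  have: #|<[x ^+ 3]>| %| 3 := order_cube_dvdn gens.
  case/primeP: (isT : prime 3) => _ d3 /d3/pred2P[] // /card1_trivg Z1.
  by move: Zt nt1; rewrite Z1 inE => /eqP->; rewrite eqxx.
have ot : #[[~ x, y, x]] = 3.
  apply/(prime_nt_dvdP (isT : prime 3)); first by rewrite order_eq1.
  by rewrite -oZ cardSg // cycle_subG.
have [k uE] : exists k, [~ x, y, y] = [~ x, y, x] ^+ k.
  apply/cycleP; have /eqP-> // : <[[~ x, y, x]]> == <[x ^+ 3]>.
  by rewrite eqEcard cycle_subG Zt oZ -[#|_|]/#[_] ot.
exists x, (x ^+ k * y * x ^+ k); split; first exact: inverted_gens_sandwich.
have Px := IP Ix; have Py := IP Iy.
have ct g n : g \in P -> [~ x, y, x] ^+ n ^ g = [~ x, y, x] ^+ n.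
  move=> Pg; apply/conjg_fixP/commgP/(central_cube gens) => //.
  exact: groupX.
have cxk : [~ x, y] ^ (x ^+ k) = [~ x, y] * [~ x, y, x] ^+ k.
  rewrite conjg_mulR commgX //; apply/commute_sym.
  exact: (central_cube gens).
have cy : [~ x, y] ^ y = [~ x, y] * [~ x, y, x] ^+ k by rewrite conjg_mulR uE.
have -> : [~ x, x ^+ k * y * x ^+ k] = [~ x, y] * [~ x, y, x] ^+ k.
  rewrite -cxk !commgMJ (_ : [~ x, x ^+ k] = 1) ?conj1g ?mulg1 ?mul1g //.
  exact/eqP/commgP/commuteX.
apply/commgP/conjg_fixP.
rewrite conjMg ct ?groupM ?groupX //; congr (_ * _).
set t := [~ x, y, x] in ct cxk cy ot *; set c := [~ x, y] in ct cxk cy *.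
rewrite !conjgM cxk (conjMg c) cy ct // (conjMg (c * _)) (conjMg c) cxk.
rewrite !ct ?groupX //.
(* Each of the three factors [x ^+ k], [y], [x ^+ k] contributes [t ^+ k], and [t] has order 3. *)
suff t3 : t ^+ (k + (k + k)) = 1 by rewrite -!mulgA -!expgD t3 mulg1.
by apply/eqP; rewrite -order_dvdn ot addnn -mul2n -mulSn dvdn_mulr.
Qed.

(** * The structure of [P], according to whether [x ^+ 3] is trivial *)

Let card_Phi_lt9 : #|F| < 9 -> #|F| = 1%N \/ #|F| = 3.
Proof.
have /p_natP[[|[|n]] -> //] : 3.-nat #|F| by apply: pgroupS (Phi_sub P) pP.
- by left.
- by right.
by rewrite ltnNge -[9]/(3 ^ 2)%N leq_exp2l.
Qed.

(** Here [Z] is trivial, so [[~ x, y]] is central and it, [x] and [y] have trivial cubes. This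
    bounds the order by 27 and leaves [F] of order 1 or 3. *)
Lemma inverted_gens_cube_trivial x y : inverted_gens x y -> x ^+ 3 = 1 ->
  3.-abelem P /\ #|P| = 9
    \/ [/\ extraspecial P, #|P| = 27 & exponent P = 3].
Proof.
move=> gens x3; have [Ix Iy defP] := gens; have Px := IP Ix; have Py := IP Iy.
have Fc : [~ x, y] \in F by rewrite commF.
have Z1 : <[x ^+ 3]> = 1 by rewrite x3 cycle1.
have y3 : y ^+ 3 = 1.
  by apply/set1gP; rewrite -Z1; apply: (mem_inverted_cube gens).
have t1 : [~ x, y, x] = 1 by apply/set1gP; rewrite -Z1; apply: (commg_Phi gens).
have u1 : [~ x, y, y] = 1 by apply/set1gP; rewrite -Z1; apply: (commg_Phi gens).
have [c3 _ _ _] := mulg_inverted_cube gens Ix.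
set c := [~ x, y] in Fc t1 u1 c3.
have lec : #|<[c]>| <= 3 by rewrite dvdn_leq // -orderE order_dvdn c3.
have nyc : y \in 'N(<[c]>) by rewrite inE -cycleJ conjg_mulR u1 mulg1.
have nxH : x \in 'N(<[y]> <*> <[c]>).
  rewrite inE conjYg -!cycleJ !conjg_mulR t1 mulg1 -[[~ y, x]]invgR -/c.
  rewrite join_subG !cycle_subG groupM ?groupV //=;
  by rewrite mem_gen // inE cycle_id ?orbT.
have le27 : #|P| <= 27.
  have sPH : P \subset <[x]> <*> (<[y]> <*> <[c]>).
    by rewrite -{1}defP genS // setUS // joing_subl.
  apply: leq_trans (subset_leq_card sPH) _.
  apply: leq_trans (card_cycle_joing_le3 nxH _) _; first by rewrite x3 group1.
  rewrite (@leq_pmul2l 3 _ 9) //.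
  apply: leq_trans (card_cycle_joing_le3 nyc _) _; first by rewrite y3 group1.
  by rewrite (@leq_pmul2l 3 _ 3).
have [|F1|F3] := card_Phi_lt9.
- by rewrite -(@ltn_pmul2l 9) // -cardP (leq_ltn_trans le27).
- left; split; last by rewrite cardP F1.
  by rewrite -trivg_Phi // trivg_card1 F1.
have oP : #|P| = 27 by rewrite cardP F3.
(* If [P] were abelian, adjoining [x] to [<[y]>] would give order at most 9. *)
right; have nabP : ~~ abelian P.
  apply/negP=> abP; have nxy : x \in 'N(<[y]>).
    by rewrite inE -cycleJ (conjg_fixP _) //; apply/commgP/(centsP abP).
  have := card_cycle_joing_le3 nxy; rewrite defP x3 group1 oP => /(_ isT).
  rewrite (@leq_pmul2l 3 9) // leqNgt => /negP[].
  by rewrite (@leq_ltn_trans 3) // dvdn_leq // -orderE order_dvdn y3.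
have esP : extraspecial P.
  by apply: (p3group_extraspecial pP nabP); rewrite oP (pfactorK 3).
split=> //; apply/(prime_nt_dvdP (isT : prime 3)).
  rewrite -dvdn1 -trivg_exponent; apply: contraNneq nabP => ->.
  exact: abelian1.
have cl2 : nil_class P <= 2 by rewrite nil_class2; case: esP => [[_ ->]].
(* In class at most 2 and odd characteristic, elements of order dividing 3 generate a subgroup of
   exponent dividing 3. *)
have <- : 'Ohm_1(P) = P; last exact: exponent_Ohm1_class2.
apply/eqP; rewrite eqEsubset Ohm_sub -{1}defP (OhmE 1 pP) join_subG !cycle_subG.
by rewrite !mem_gen // !inE ?Px ?Py ?x3 ?y3 /=.
Qed.

(** Now [Z] has order 3 and is generated by [t = [~ x, y, x]]. The cubes of all the elements
    [x ^+ l * y * x ^+ l] are nontrivial; [l = 0, 1, 2] force [y ^+ 3 = t]. *)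
Lemma inverted_gens_cube_nontrivial x y :
    inverted_gens x y -> commute [~ x, y] y -> x ^+ 3 != 1 ->
  is_SmallGroup_81_10 P.
Proof.
move=> gens cy ntx3; have [Ix Iy defP] := gens.
have Px := IP Ix; have Py := IP Iy.
have oZ : #|<[x ^+ 3]>| = 3.
  apply/(prime_nt_dvdP (isT : prime 3)); first by rewrite order_eq1.
  exact: order_cube_dvdn gens.
have Fc : [~ x, y] \in F by rewrite commF.
have Pc : [~ x, y] \in P by rewrite groupR.
have [c3 _ _ _] := mulg_inverted_cube gens Ix.
have Zt := commg_Phi gens Fc Ix.
have ntt : [~ x, y, x] != 1.
  apply: contraNneq ntx3 => /eqP/commgP cx; apply/eqP.
  exact: (expg3_central_commg gens).
have central := central_cube gens.
have nZ1 l : (x ^+ l * y * x ^+ l) ^+ 3 != 1.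
  by rewrite -order_eq1 /order (cycle_cube_sandwich gens) oZ.
have := nZ1 0%N; rewrite mul1g mulg1 => nty3.
have Zx3 := cycle_id (x ^+ 3).
have Zy3 := mem_inverted_cube gens Iy.
(* If [F] had fewer than 9 elements it would equal [Z], so [[~ x, y]] would be central and [t]
   trivial. *)
have leP : 81 <= #|P|.
  rewrite cardP (@leq_pmul2l 9 9) // leqNgt; apply/negP=> /card_Phi_lt9 F13.
  have sZF : <[x ^+ 3]> \subset F by rewrite cycle_subG cubeF.
  have eqZF : <[x ^+ 3]> = F.
    by apply/eqP; rewrite eqEcard sZF oZ; case: F13 => ->.
  by case/eqP: ntt; apply/eqP/commgP/central; rewrite ?eqZF.
set c := [~ x, y] in cy Fc Pc c3 Zt ntt *.
set t := [~ c, x] in Zt ntt *.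
have ot : #[t] = 3.
  apply/(prime_nt_dvdP (isT : prime 3)); first by rewrite order_eq1.
  by rewrite -oZ cardSg // cycle_subG.
have t3 : t ^+ 3 = 1 by rewrite -ot expg_order.
have ZE z : z \in <[x ^+ 3]> -> z != 1 -> z = t \/ z = t ^+ 2.
  have -> : <[x ^+ 3]> = <[t]>.
    by apply/eqP; rewrite eq_sym eqEcard cycle_subG Zt oZ -[#|_|]/#[_] ot.
  case/cyclePmin=> [[|[|[|k]]]]; rewrite ot // => _ -> nz; [|left|right] => //.
  by rewrite eqxx in nz.
have ct g : g \in P -> commute t g by apply: central.
have cg1 (z g : gT) : commute z g -> [~ z, g] = 1.
  by move=> czg; apply/eqP/commgP.
have cx3 g : g \in P -> commute (x ^+ 3) g by apply: central.
have x9 : (x ^+ 3) ^+ 3 = 1 by rewrite -{2}oZ expg_order.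
have w1 : (x ^+ 1 * y * x ^+ 1) ^+ 3 = y ^+ 3 * (x ^+ 3) ^+ 2 * t^-1.
  have dE : [~ x ^+ 2, y] = c ^+ 2 * t.
    rewrite !expgS expg0 mulg1 commMgJ -/c conjg_mulR -/t -mulgA (ct c) //.
    by rewrite mulgA mulg1.
  have dx : [~ c ^+ 2 * t, x] = t ^+ 2.
    rewrite commMgJ commXg; last exact/commute_sym/ct.
    rewrite (cg1 t x (ct x Px)) mulg1 (conjg_fixP _) //; apply/eqP/cg1.
    exact/commute_sym/commuteX.
  have dxx : [~ c ^+ 2 * t, x ^+ 2] = t.
    rewrite commgX dx; last exact/commuteX/commute_sym/ct.
    by rewrite -expgM (expgD t 3 1) t3 mul1g.
  have dy : [~ c ^+ 2 * t, y] = 1.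
    apply/cg1/commute_sym/commuteM; last exact/commute_sym/ct.
    exact/commuteX/commute_sym.
  rewrite (sandwich_cube gens) dE dxx dy mulg1.
  by rewrite -!expgM.
have w2 : (x ^+ 2 * y * x ^+ 2) ^+ 3 = y ^+ 3 * x ^+ 3 * t^-1.
  have dE : [~ x ^+ 4, y] = c.
    by rewrite (expgD x 3 1) commMgJ (cg1 _ y (cx3 y Py)) conj1g mul1g.
  have dx : [~ c, x ^+ 4] = t.
    rewrite (expgD x 3 1) commgMJ (cg1 c (x ^+ 3) (commute_sym (cx3 c Pc))).
    by rewrite conj1g mulg1.
  rewrite (sandwich_cube gens) dE dx (cg1 c y cy) mulg1.
  by rewrite -(expgM x 4 3) (expgD x 9 3) (expgM x 3 3) x9 mul1g.
(* Were [y ^+ 3 = t ^+ 2], the cube in [w1] (if [x ^+ 3 = t]) or in [w2] (if [x ^+ 3 = t ^+ 2])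
   would be [t ^+ 3 = 1]. *)
have y3 : y ^+ 3 = t.
  have [//|y3] := ZE _ Zy3 nty3; have [x3|x3] := ZE _ Zx3 ntx3.
    case/eqP: (nZ1 1%N).
    by rewrite w1 y3 x3 -expgD (expgD t 3 1) t3 mul1g mulgV.
  case/eqP: (nZ1 2).
  by rewrite w2 y3 x3 -expgD (expgD t 3 1) t3 mul1g mulgV.
have tV : t^-1 = t ^+ 2 by apply/(mulgI t); rewrite mulgV -expgS.
have cV : c^-1 = [~ y, x] by rewrite invgR.
have cVx : [~ c^-1, x] = t^-1.
  rewrite commgEl invgK conjVg conjg_mulR -/t invMg.
  have -> : t^-1 * c^-1 = c^-1 * t^-1 by rewrite -!invMg ct.
  exact: mulKVg.
have ctV g : g \in P -> commute t^-1 g.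
  by move=> Pg; apply/commute_sym/commuteV/commute_sym/ct.
have tV3 : t^-1 ^+ 3 = 1 by rewrite expgVn t3 invg1.
have y3V : y ^+ 3 = t^-1 ^+ 2 by rewrite y3 tV -expgM (expgD t 3 1) t3 mul1g.
(* In both cases [f4 = t^-1] and [f2 = y]. The relation [f1 ^+ 3 = f4] forces [f1 = x] when
   [x ^+ 3 = t ^+ 2] and [f1 = x^-1] when [x ^+ 3 = t]. *)
have [x3|x3] := ZE _ Zx3 ntx3; last first.
  apply: (@isoGrp_SmallGroup_81_10 _ _ x y c^-1 t^-1) => //.
  - by rewrite x3 tV.
  - by rewrite expgVn c3 invg1.
  - by apply/cg1/commute_sym/commuteV/commute_sym.
  - exact/cg1/ctV.
  - exact/cg1/ctV.
  - by apply/cg1/ctV; rewrite groupV.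
have cxV : c ^ x^-1 = c * t^-1.
  apply: (canLR (conjgK x)); rewrite conjMg conjg_mulR -/t.
  by rewrite (conjg_fixP _) ?mulgK //; apply/eqP/cg1/ctV.
apply: (@isoGrp_SmallGroup_81_10 _ _ x^-1 y (c * t^-1) t^-1) => //.
- by rewrite expgVn x3.
- by rewrite expgMn ?c3 ?tV3 ?mulg1 //; apply/commute_sym/ctV.
- by rewrite -cxV /conjg /c /commg /conjg !invgK !mulgA mulgV mul1g.
- rewrite commgEl conjMg cxV (conjg_fixP _) ?mulKg //.
  by apply/eqP/cg1/ctV; rewrite groupV.
- by apply/cg1/commute_sym/commuteM; apply: commute_sym => //; apply: ctV.
- by apply/cg1/ctV; rewrite groupV.
- exact/cg1/ctV.
- by apply/cg1/ctV; rewrite groupM ?groupV // groupR.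
- by rewrite cycleV.
Qed.

End InvertedGenerators.

(** * From maximal pairs to inverted generators *)

Lemma grank_le1_cyclic (gT : finGroupType) (G : {group gT}) :
  ('m(G) <= 1) = cyclic G.
Proof.
apply/idP/cyclicP=> [|[x ->]]; last by rewrite -(cards1 x) grank_min.
have [B <- <-] := grank_witness G; rewrite leq_eqVlt ltnS leqn0 cards_eq0.
case/orP=> [/cards1P[x ->]|/eqP->]; first by exists x.
by exists 1; rewrite gen0 cycle1.
Qed.

(** Each [v] is fixed or inverted, since [<[v]>] has at most 3 elements. If [g] is inverted but not
    fixed and [h] is fixed, the image of [g * h] forces [h = h^-1]. *)
Lemma power_automorphism_abelem3 (gT : finGroupType) (V : {group gT})
    (b : {perm gT}) :
    3.-abelem V -> power_automorphism V b -> b != 1 ->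
  {in V, forall v, b v = v^-1}.
Proof.
move=> abV [Ab pow_b] ntb; have [_ cVV V3] := and3P abV.
have b1 : b 1 = 1 by rewrite -(autmE Ab) morph1.
have bM : {in V &, {morph b : x y / x * y}} := morphicP (Aut_morphic Ab).
have bvE v : v \in V -> b v = v \/ b v = v^-1.
  move=> Vv; have sv : <[v]> \subset V by rewrite cycle_subG.
  have : b v \in <[v]> by rewrite -(pow_b _ sv) imset_f ?cycle_id.
  have v3 : v ^+ 3 = 1 by apply: (exponentP V3).
  have ov : #[v] <= 3 by rewrite dvdn_leq // order_dvdn v3.
  case/cyclePmin=> [[|[|[|k]]]] ltk bv; last by have := leq_trans ltk ov.
  - by left; rewrite bv; apply: (@perm_inj _ b); rewrite bv b1.
  - by left.
  by right; rewrite bv; apply: (mulgI v); rewrite mulgV -expgS.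
have [g Vg ng] : exists2 g, g \in V & b g != g.
  apply/exists_inP; rewrite -negb_forall_in.
  apply: contra ntb => /forall_inP fix_b.
  by apply/eqP; apply: (eq_Aut Ab (group1 _)) => v /fix_b/eqP->; rewrite perm1.
have bg : b g = g^-1 by case: (bvE g Vg) ng => // ->; rewrite eqxx.
move=> h Vh; have [bh|//] := bvE h Vh.
have := bvE (g * h) (groupM Vg Vh); rewrite bM // bg bh => -[/mulIg e|].
  by rewrite bg e eqxx in ng.
by rewrite (centsP cVV g Vg h Vh) invMg => /mulgI.
Qed.

Lemma inversion_power_automorphism (gT : finGroupType) (K : {group gT})
    (b : {perm gT}) :
  b \in Aut K -> {in K, forall k, b k = k^-1} -> power_automorphism K b.
Proof.
move=> Ab bV; split=> // L sLK; apply/eqP.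
rewrite eqEcard (card_imset _ (@perm_inj _ b)) leqnn andbT.
apply/subsetP=> _ /imsetP[k Lk ->].
by rewrite bV ?groupV ?(subsetP sLK).
Qed.

(** The induced automorphism inverts the generators of an abelian quotient, hence all of it. For a
    proper [H] this is what the maximality condition excludes. *)
Lemma nontrivial_power_inverted_gens (gT : finGroupType) (P : {group gT})
    (a : {perm gT}) (u v : gT) (H := (<[u]> <*> <[v]>)%G) :
    3.-group P -> a \in Aut P -> u \in P -> v \in P ->
    a u = u^-1 -> a v = v^-1 -> ~~ cyclic H ->
  a @: H = H /\ nontrivial_power_on_frattini_quotient H a.
Proof.
move=> pP Aa Pu Pv au av ncH.
have sHP : H \subset P by rewrite join_subG !cycle_subG Pu.
have pH := pgroupS sHP pP.
have aH : a @: H = H.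
  have <- : autm Aa @* H = a @: H.
    by rewrite morphimEsub //; apply: eq_imset => g; rewrite autmE.
  rewrite morphimY ?cycle_subG // !morphim_cycle //= !autmE au av.
  by rewrite !cycleV.
split=> //.
have [b [[Ab bE] _]] := exists_unique_frattini_quotient_aut Aa sHP aH.
have Hu : u \in H by rewrite -cycle_subG joing_subl.
have Hv : v \in H by rewrite -cycle_subG joing_subr.
have nPhi := normal_norm (Phi_normal H).
have abK : 3.-abelem (H / 'Phi(H)) := Phi_quotient_abelem pH.
have bM : {in H / 'Phi(H) &, {morph b : x y / x * y}}.
  exact: morphicP (Aut_morphic Ab).
pose S := [set k in H / 'Phi(H) | b k == k^-1].
have gS : group_set S.
  apply/group_setP; split=> [|k l].
    by rewrite inE group1 -(autmE Ab) morph1 invg1 eqxx.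
  case/setIdP=> Kk /eqP bk /setIdP[Kl /eqP bl].
  rewrite inE groupM //= bM // bk bl.
  by rewrite -invMg (centsP (abelem_abelian abK) k Kk l Kl).
have bV : {in H / 'Phi(H), forall k, b k = k^-1}.
  have sKS : H / 'Phi(H) \subset Group gS.
    rewrite quotientY ?cycle_subG ?(subsetP nPhi) //.
    rewrite !quotient_cycle ?(subsetP nPhi) //.
    rewrite join_subG !cycle_subG !inE !mem_quotient //= !bE // au av.
    by rewrite !morphV ?(subsetP nPhi) //= !eqxx.
  by move=> k /(subsetP sKS)/setIdP[_ /eqP].
exists b; split=> //; first exact: inversion_power_automorphism.
(* If inversion were trivial on the quotient, every element would have order dividing both 2 and
   3. *)
apply: contraNneq ncH => b1; apply: Phi_quotient_cyclic.
suff -> : H / 'Phi(H) = 1 by apply: cyclic1.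
apply/trivgP/subsetP=> k Kk; rewrite inE -order_eq1 -dvdn1 -[1%N]/(gcdn 2 3).
rewrite dvdn_gcd !order_dvdn.
have [_ _ /exponentP->] := and3P abK; rewrite // eqxx andbT.
have kV : k^-1 = k by rewrite -bV // b1 perm1.
by rewrite expgS expg1 -{1}kV mulVg.
Qed.

Theorem proposition5p4 (p q : nat) (gT : finGroupType) (P : {group gT})
    (a : {perm gT}) :
  prime p -> prime q -> maximal_pair p q 2 P a -> p = 3 ->
  [\/ 3.-abelem P /\ #|P| = 9,
      [/\ extraspecial P, #|P| = 27 & exponent P = 3]
    | is_SmallGroup_81_10 P].
Proof.
move=> _ q_pr maxpair p3; subst p.
case: maxpair => _ _ q_dvd pP Aa oa rankP _ [b [[Ab bE] pow_b ntb]] maxP.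
have aK : involutive a.
  have q2 : q = 2.
    apply/(prime_nt_dvdP (isT : prime 2)) => //.
    by rewrite neq_ltn prime_gt1 ?orbT.
  by move=> g; rewrite -permM -[a * a]/(a ^+ 2) -q2 -oa expg_order perm1.
have ncP : ~~ cyclic P by rewrite -grank_le1_cyclic rankP.
have abPF := Phi_quotient_abelem pP; have nFP := normal_norm (Phi_normal P).
have cardP : #|P| = (9 * #|'Phi(P)|)%N.
  rewrite -(Lagrange (Phi_sub P)) mulnC -card_quotient //; congr (_ * _)%N.
  have := contra (@Phi_quotient_cyclic _ P) ncP.
  rewrite (abelem_cyclic abPF) -ltnNge => ge2.
  rewrite (card_pgroup (abelem_pgroup abPF)).
  suff le2 : logn 3 #|P / 'Phi(P)| <= 2.
    by rewrite (_ : logn 3 _ = 2) //; apply/eqP; rewrite eqn_leq le2.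
  rewrite -(rank_abelem abPF) -grank_abelian ?(abelem_abelian abPF) //.
  by rewrite (leq_trans (quotient_grank nFP)) ?rankP.
have cycI u v :
    u \in [set g in P | a g == g^-1] -> v \in [set g in P | a g == g^-1] ->
    <[u]> <*> <[v]> \proper P -> cyclic (<[u]> <*> <[v]>).
  (* A noncyclic subgroup generated by [u] and [v] has the same generator number 2 as [P], so the
     maximality condition applies to it. *)
  case/setIdP=> Pu /eqP au /setIdP[Pv /eqP av] prH; apply: contraT => ncH.
  have [aH powH] := nontrivial_power_inverted_gens pP Aa Pu Pv au av ncH.
  have [|/(_ aH)|/(_ powH)] // := maxP _ prH.
  rewrite rankP; apply/eqP; rewrite eqn_leq ltnNge grank_le1_cyclic ncH andbT.
  rewrite /= joing_idl joing_idr.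
  by rewrite (leq_trans (grank_min _)) // cards2; case: eqP.
have [x [y gens]] : exists x y, inverted_gens P a x y.
  have [B defP cardB] := grank_witness P.
  have /eqP/cards2P[x0 [y0 [_ defB]]] : #|B| = 2 by rewrite cardB rankP.
  have [Px0 Py0] : x0 \in P /\ y0 \in P.
    by rewrite -defP defB; split; rewrite mem_gen // !inE eqxx ?orbT.
  (* Modulo ['Phi(P)], [w g] is [g ^+ 2], and squaring is invertible in exponent 3; so [w x0] and
     [w y0] still generate [P]. *)
  pose w g := (a g)^-1 * g.
  have coset_w g : g \in P -> coset 'Phi(P) (w g) = coset 'Phi(P) g ^+ 2.
    move=> Pg.
    have Pag : a g \in P by apply: Aut_closed.
    rewrite morphM ?morphV ?groupV ?(subsetP nFP) //= -bE //.
    by rewrite (power_automorphism_abelem3 abPF pow_b ntb) ?mem_quotient ?invgK.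
  have Pw g : g \in P -> w g \in P.
    by move=> Pg; rewrite groupM ?groupV // Aut_closed.
  exists (w x0), (w y0); split; try exact: inverted_divg.
  have sub : <[w x0]> <*> <[w y0]> \subset P.
    by rewrite join_subG !cycle_subG !Pw.
  rewrite -[LHS]genGid; apply: Phi_nongen; apply/eqP; rewrite eqEsubset.
  rewrite join_subG Phi_sub sub -{1}defP gen_subG defB /=; 
  pose X := ('Phi(P) <*> (<[w x0]> <*> <[w y0]>))%G.
  rewrite -[_ <*> _]/(gval X).
  suff memX g : g \in P -> w g \in X -> g \in X.
    apply/subsetP=> g /set2P[]->; apply: memX; rewrite // -cycle_subG /=.
      exact: subset_trans (joing_subl _ _) (joing_subr _ _).
    exact: subset_trans (joing_subr _ _) (joing_subr _ _).
  (* [w g ^+ 2] is congruent to [g ^+ 4], that is to [g], so the other factor lies in ['Phi(P)]. *)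
  move=> Pg Xw; rewrite -(mulKVg (w g ^+ 2) g) groupM ?groupX //.
  apply: subsetP (joing_subl _ _) _ _; apply: coset_idr.
    by rewrite (subsetP nFP) ?groupM ?groupV ?groupX ?Pw.
  rewrite morphM ?morphV ?morphX ?groupV ?(subsetP nFP) ?groupX ?Pw //=.
  rewrite coset_w //.
  have [_ _ /exponentP/(_ _ (mem_quotient _ Pg)) g3] := and3P abPF.
  by rewrite -expgM (expgD _ 3 1) g3 mul1g mulVg.
have [x' [y' [gens' cy']]] :=
  exists_commuting_inverted_gens pP Aa aK ncP cycI gens.
have [x3|nx3] := eqVneq (x' ^+ 3) 1.
  have [] := inverted_gens_cube_trivial pP Aa aK ncP cardP cycI gens' x3.
    by constructor 1.
  by constructor 2.
constructor 3.
exact: (inverted_gens_cube_nontrivial pP Aa aK ncP cardP cycI gens' cy').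
Qed.
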